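(* Let $Z$ be an irreducible complex hermitian Jordan triple and let $M^\epsilon=G^\epsilon/K$, $\epsilon\in\{-1,0,1\}$, be the associated hermitian symmetric spaces of non-compact type ($\epsilon=-1$), flat type ($\epsilon=0$) and compact type ($\epsilon=1$). Let $H$ be a connected complex Lie group and $L\subset H$ a maximal compact subgroup. Then there is a canonical one-to-one correspondence between the sets classifying the hermitian homogeneous $H$-bundles $(Q,P)$, endowed with an integrable invariant complexion $J$, over the hermitian symmetric spaces of compact type, non-compact type and flat type, respectively.
   Context: **Jordan triples and the spaces $M^\epsilon$.** A hermitian Jordan triple is a finite-dimensional complex vector space $Z$ with a product $(u,v,w)\mapsto\{uv^*w\}$, symmetric bilinear in $(u,w)$, conjugate-linear in $v$, such that with $(u\Box v^* )z:=\{uv^*z\}$ one has $[u\Box v^*,z\Box w^*]=\{uv^*z\}\Box w^*-z\Box\{wu^*v\}^*$. $Z$ is assumed positive and irreducible. Put $Q_zw=\{zw^*z\}$, $B_{z,w}=\mathrm{id}-2z\Box w^*+Q_zQ_w$, and $z^w=B_{z,w}^{-1}(z-Q_zw)$ when $B_{z,w}$ is invertible. $M^0=Z$; $M^-=M^{-1}$ is the connected component containing $0$ of $\{z\in Z:\det B_{z,z}\ne0\}$ (a bounded symmetric domain); $M^+=M^{1}=(Z\times Z)/\sim$ is the compact manifold of classes $[z,c]=[z^{d-c},d]$ whenever $B_{z,c-d}$ is invertible; $Z\subset M^+$ via $z\mapsto[z,0]$. The base point is $o=0$, $T_oM^\epsilon=Z$, and $j$ denotes the complex structure of $M^\epsilon$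 ($j_o$ = multiplication by $\sqrt{-1}$). $K\subset GL(Z)$ is the identity component of the group of Jordan triple automorphisms; $G^\epsilon$ is the connected real Lie group generated by $K$ and the transvections $z\mapsto w+B_{w,-\epsilon w}^{1/2}z^{\epsilon w}$ ($w\in Z\cap M^\epsilon$); it acts transitively and holomorphically on $M^\epsilon$, and $K$ is the stabilizer of $o$ for every $\epsilon$. **Bundles.** Let $M=M^\epsilon$, $G=G^\epsilon$, and let $\mathfrak h$ be the Lie algebra of $H$. A homogeneous $H$-bundle is a smooth principal $H$-bundle $\pi:Q\to M$ with a smooth left $G$-action commuting with the right $H$-action and covering the $G$-action on $M$. It is hermitian if it carries a $G$-invariant principal subbundle $P\subset Q$ with structure group $L$. **Complexions.** Write $L_q^Q(h)=R_h^Q(q)=qh$, $L_g^Q(q)=gq$ ($q\in Q,\ h\in H,\ g\in G$). A complexion on $Q$ is an almost complex structure $J$ on $Q$ with $(d_q\pi)J_q=j_{\pi(q)}(d_q\pi)$, $(d_qR_h^Q)J_q=J_{qh}(d_qR_h^Q)$, and $J_q(d_eL_q^Q)\beta=(d_eL_q^Q)(\sqrt{-1}\beta)$ for $\beta\in\mathfrak h$. It is invariant if $(d_qL_g^Q)J_q=J_{gq}(d_qL_g^Q)$ for all $g\in G$; it is integrable if its Nijenhuis tensor vanishes. **Classifying sets.** The set classifying (up to isomorphism) the hermitian homogeneous $H$-bundles with integrable invariant complexion over $M^\epsilon$ is the set of pairs $(f,b)$, where $f:K\to L\subset H$ is a homomorphism and $b:T_oM^\epsilon\to\mathfrak h$ is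 a $\mathbb C$-antilinear map which is $f$-covariant, i.e. $\mathrm{Ad}_{f(k)}\circ b=b\circ k$ for all $k\in K$ ($k$ acting linearly on $T_oM^\epsilon=Z$), and satisfies $[b\,u,b\,v]=0$ for all $u,v$, modulo the equivalence $(f,b)\sim(\ell f(\cdot)\ell^{-1},\mathrm{Ad}_\ell\circ b)$, $\ell\in L$. *)

(* Defs.v *)
From HB Require Import structures.
From mathcomp Require Import all_boot all_order all_algebra complex.
From mathcomp Require Import all_classical all_reals all_analysis.

Set Implicit Arguments.
Unset Strict Implicit.
Unset Printing Implicit Defensive.

Import Order.TTheory GRing.Theory Num.Theory numFieldNormedType.Exports.

Local Open Scope classical_set_scope.
Local Open Scope ring_scope.

(* R[i], packaged so that its metric topology (and that of its matrices) is
   found by instance resolution. *)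
Definition Cplx (R : realType) : numClosedFieldType := R[i].

Lemma mx_entry_continuous (R : realType) (X : topologicalType) (p q : nat)
    (F : X -> 'M[Cplx R]_(p, q)) :
  (forall i j, continuous (fun x => F x i j)) -> continuous F.
Proof.
move=> cF x U [P PF PU].
have : \forall y \near x, forall i j, P i j (F y i j).
  apply: filter_forall => i; apply: filter_forall => j; exact: (cF i j x _ (PF i j)).
by apply: filterS => y Py; exact: PU.
Qed.

Lemma mulmx_continuous (R : realType) (m p q : nat) (A : 'M[Cplx R]_(m, p)) :
  continuous (fun B : 'M[Cplx R]_(p, q) => A *m B).
Proof.
apply: mx_entry_continuous => i j.
under [X in continuous X]eq_fun do rewrite mxE.
apply: continuous_big => [|s _ B]; first exact: add_continuous.
exact: (continuous_comp (@coord_continuous _ _ _ s j B) (@mulrl_continuous _ (A i s) _)).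
Qed.

(** * Hermitian Jordan triples *)

(* The finite-dimensional complex vector space Z is C^n, as column vectors;
   [tri u v w] is {u v^* w}. *)
Record jordanTriple (R : realType) (n : nat) := JordanTriple {
  tri :> 'cV[Cplx R]_n -> 'cV[Cplx R]_n -> 'cV[Cplx R]_n -> 'cV[Cplx R]_n;
  triC : forall u v w, tri u v w = tri w v u;
  tri_linear : forall v w a u u',
    tri (a *: u + u') v w = a *: tri u v w + tri u' v w;
  tri_antilinear : forall u w a v v',
    tri u (a *: v + v') w = a^* *: tri u v w + tri u v' w;
  (* [u box v^*, z box w^*] = {u v^* z} box w^* - z box {w u^* v}^* *)
  tri_jordan : forall u v z w x,
    tri u v (tri z w x) - tri z w (tri u v x) =
    tri (tri u v z) w x - tri z (tri w u v) x }.

Section JordanTriple.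
Context {R : realType} {n : nat}.
Local Notation C := (Cplx R).
Local Notation Z := 'cV[C]_n.
Variable T : jordanTriple R n.
Implicit Types (u v w x z c d : Z) (k l : 'M[C]_n).

Definition mx_of (F : Z -> Z) : 'M[C]_n := \matrix_(i, j) F (delta_mx j 0) i 0.

Definition tri_box u v : 'M[C]_n := mx_of (T u v).

Definition tri_quad z w : Z := T z w z.

Definition bergman z w : 'M[C]_n :=
  1%:M - 2 *: tri_box z w + mx_of (fun x => tri_quad z (tri_quad w x)).

Definition quasi_invertible z w : bool := \det (bergman z w) != 0.

Definition quasi_inverse z w : Z := invmx (bergman z w) *m (z - tri_quad z w).

(* Positive definiteness of the trace form, whose value at (u, v) is the trace
   of u box v^*. *)
Definition positive_triple : Prop := forall z, z != 0 -> 0 < \tr (tri_box z z).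

Definition triple_ideal (A : {vspace Z}) : Prop :=
  forall u v w, u \in A -> T u v w \in A /\ T v u w \in A.

Definition irreducible_triple : Prop :=
  (0 < n)%N /\
  forall A B : {vspace Z}, triple_ideal A -> triple_ideal B ->
    (A + B = fullv)%VS -> (A :&: B = 0)%VS -> A = 0%VS \/ B = 0%VS.

(** * The group K *)

Definition automorphisms : set 'M[C]_n :=
  [set k | k \in unitmx /\
           forall u v w, k *m T u v w = T (k *m u) (k *m v) (k *m w)].

Definition Kaut : set 'M[C]_n := connected_component automorphisms 1%:M.

Lemma aut1 : automorphisms 1%:M.
Proof. by split=> [|u v w]; rewrite ?unitmx1 // !mul1mx. Qed.

Lemma autM k l :
  automorphisms k -> automorphisms l -> automorphisms (k *m l).
Proof.
move=> [uk kT] [ul lT]; split=> [|u v w]; first by rewrite unitmx_mul uk ul.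
by rewrite -!mulmxA lT kT.
Qed.

Lemma autV k : automorphisms k -> automorphisms (invmx k).
Proof.
move=> [uk kT]; split=> [|u v w]; first by rewrite unitmx_inv.
apply: (can_inj (mulKmx uk)).
by rewrite kT !mulKVmx.
Qed.

Lemma K_aut k : Kaut k -> automorphisms k.
Proof. exact: connected_component_sub. Qed.

Lemma K1 : Kaut 1%:M.
Proof. exact: connected_component_refl aut1. Qed.

Lemma mulmx_K_connected k : connected [set k *m l | l in Kaut].
Proof.
apply: connected_continuous_connected; first exact: component_connected.
exact/continuous_subspaceT/mulmx_continuous.
Qed.

Lemma K_M k l : Kaut k -> Kaut l -> Kaut (k *m l).
Proof.
move=> Kk Kl.
apply: (connected_component_trans Kk); exists [set k *m l' | l' in Kaut]; last by exists l.
split; last exact: mulmx_K_connected.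
  by exists 1%:M; [exact: K1|rewrite mulmx1].
by move=> _ [l' Kl' <-]; apply: autM; exact: K_aut.
Qed.

Lemma K_V k : Kaut k -> Kaut (invmx k).
Proof.
move=> Kk; have [uk _] := K_aut Kk.
exists [set invmx k *m l | l in Kaut]; last by exists 1%:M; [exact: K1|rewrite mulmx1].
split; last exact: mulmx_K_connected.
  by exists k; rewrite ?mulVmx.
by move=> _ [l Kl <-]; apply: autM; [exact/autV/K_aut|exact: K_aut].
Qed.

(** * The spaces M^epsilon *)

Lemma mx_ofE (F : Z -> Z) : linear F -> forall x, mx_of F *m x = F x.
Proof.
move=> Flin x.
pose F' : {linear Z -> Z} := HB.pack F (GRing.isLinear.Build _ _ _ _ F Flin).
rewrite -[F x]/(F' x) {2}(matrix_sum_delta x) linear_sum.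
apply/colP => i; rewrite mxE summxE; apply: eq_bigr => j _.
by rewrite big_ord1 linearZ !mxE mulrC.
Qed.

Lemma mulmx_colI (A B : 'M[C]_n) : (forall x, A *m x = B *m x) -> A = B.
Proof.
move=> AB; apply/matrixP => i j.
by have /colP/(_ i) := AB (delta_mx j 0); rewrite -!colE !mxE.
Qed.

Lemma boxE u v x : tri_box u v *m x = T u v x.
Proof. by apply: mx_ofE => a y z; rewrite !(triC _ u v) tri_linear. Qed.

Lemma bergmanE z w x :
  bergman z w *m x = x - 2 *: T z w x + tri_quad z (tri_quad w x).
Proof.
rewrite /bergman mulmxDl mulmxBl mul1mx -scalemxAl boxE mx_ofE // => a y y'.
by rewrite /tri_quad !tri_antilinear conjCK.
Qed.

Definition Mminus : set Z :=
  connected_component [set z | quasi_invertible z z] 0.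

(* The class [z, c] of a pair (z, c), as a subset of Z x Z:
   [z, c] = [z^(c - d), d] whenever B_(z, c - d) is invertible. *)
Definition Mplus_class (p : Z * Z) : set (Z * Z) :=
  [set q | quasi_invertible p.1 (p.2 - q.2) /\
           q.1 = quasi_inverse p.1 (p.2 - q.2)].

(* epsilon = -1, 0, 1, respectively. *)
Inductive hss_type := NonCompact | Flat | Compact.

Definition Meps (e : hss_type) : Type :=
  match e with
  | NonCompact => set_type Mminus
  | Flat => Z
  | Compact => set_type (range Mplus_class)
  end.

Lemma quad_aut k z w :
  automorphisms k -> tri_quad (k *m z) (k *m w) = k *m tri_quad z w.
Proof. by case=> _ kT; rewrite /tri_quad kT. Qed.

Lemma bergman_aut k z w :
  automorphisms k -> bergman (k *m z) (k *m w) = k *m bergman z w *m invmx k.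
Proof.
move=> kaut; have [uk kT] := kaut.
suff E x : bergman (k *m z) (k *m w) *m (k *m x) = k *m bergman z w *m x.
  apply: (can_inj (mulmxK uk)); rewrite mulmxKV //.
  by apply: mulmx_colI => x; rewrite -[LHS]mulmxA E.
rewrite -[RHS]mulmxA !bergmanE !quad_aut // -kT.
by rewrite mulmxDr mulmxBr -scalemxAr.
Qed.

Lemma quasi_invertible_aut k z w : automorphisms k ->
  quasi_invertible (k *m z) (k *m w) = quasi_invertible z w.
Proof.
move=> kaut; have [uk _] := kaut.
have dk : \det k \is a GRing.unit by rewrite -unitmxE.
by rewrite /quasi_invertible (bergman_aut _ _ kaut) 2!det_mulmx det_inv mulrAC
  (mulrV dk) mul1r.
Qed.

Lemma quasi_inverse_aut k z w : automorphisms k -> quasi_invertible z w ->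
  quasi_inverse (k *m z) (k *m w) = k *m quasi_inverse z w.
Proof.
move=> kaut zw; have [uk _] := kaut.
have uB : bergman z w \in unitmx by rewrite unitmxE unitfE.
have uB' : bergman (k *m z) (k *m w) \in unitmx.
  by rewrite unitmxE unitfE -/(quasi_invertible _ _) quasi_invertible_aut.
apply: (can_inj (mulKmx uB')); rewrite mulKVmx // quad_aut // -mulmxBr.
by rewrite (bergman_aut _ _ kaut) -!mulmxA (mulKmx uk) (mulKVmx uB).
Qed.

Lemma Mminus0 : Mminus 0.
Proof.
apply: connected_component_refl; rewrite /quasi_invertible /=.
suff -> : bergman 0 0 = 1%:M by rewrite det1 oner_eq0.
have T0 v w : T 0 v w = 0.
  by have := tri_linear T v w (-1) 0 0; rewrite scaler0 addr0 scaleN1r addNr.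
by apply: mulmx_colI => x; rewrite bergmanE /tri_quad !T0 scaler0 subr0 addr0 mul1mx.
Qed.

Lemma Mminus_aut k z : automorphisms k -> Mminus z -> Mminus (k *m z).
Proof.
move=> kaut [A [A0 sA cA] Az]; exists [set k *m x | x in A]; last by exists z.
split; first by exists 0; rewrite ?mulmx0.
  by move=> _ [x Ax <-] /=; rewrite quasi_invertible_aut //; exact: sA.
apply: connected_continuous_connected => //.
exact/continuous_subspaceT/mulmx_continuous.
Qed.

Definition Mplus_image k (m : set (Z * Z)) : set (Z * Z) :=
  [set (k *m p.1, k *m p.2) | p in m].

Lemma Mplus_image_class k p : automorphisms k ->
  Mplus_image k (Mplus_class p) = Mplus_class (k *m p.1, k *m p.2).
Proof.
have sub h r : automorphisms h ->
    Mplus_image h (Mplus_class r) `<=` Mplus_class (h *m r.1, h *m r.2).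
  move=> haut _ [q [qi q1] <-]; rewrite /Mplus_class /= -mulmxBr.
  by rewrite (quasi_invertible_aut _ _ haut) (quasi_inverse_aut haut qi) q1.
move=> kaut; have [uk _] := kaut; apply/seteqP; split=> [|q Hq]; first exact: sub.
exists (invmx k *m q.1, invmx k *m q.2) => /=; last first.
  by rewrite 2!(mulKVmx uk) -surjective_pairing.
have := sub _ (k *m p.1, k *m p.2) (autV kaut) (invmx k *m q.1, invmx k *m q.2).
rewrite [in X in _ -> X]/= 2!(mulKmx uk) -surjective_pairing; apply.
by exists q.
Qed.

Lemma Mminus_act_subproof (k : set_type Kaut) (z : set_type Mminus) :
  val k *m val z \in Mminus.
Proof. by apply/mem_set/Mminus_aut; [exact/K_aut/set_valP|exact: set_valP]. Qed.

Lemma Mplus_act_subproof (k : set_type Kaut) (m : set_type (range Mplus_class)) :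
  Mplus_image (val k) (val m) \in range Mplus_class.
Proof.
have [p _ <-] := set_valP m; apply/mem_set; rewrite Mplus_image_class.
  by exists (val k *m p.1, val k *m p.2).
exact/K_aut/set_valP.
Qed.

Definition Mminus_act (k : set_type Kaut) (z : set_type Mminus) : set_type Mminus :=
  exist _ (val k *m val z) (Mminus_act_subproof k z).

Definition Mplus_act (k : set_type Kaut) (m : set_type (range Mplus_class)) :
    set_type (range Mplus_class) :=
  exist _ (Mplus_image (val k) (val m)) (Mplus_act_subproof k m).

(* The action of K on M^epsilon (extending z |-> k z from Z to Z x Z / ~ when
   epsilon = 1). *)
Definition K_act (e : hss_type) (k : set_type Kaut) : Meps e -> Meps e :=
  match e return Meps e -> Meps e with
  | NonCompact => Mminus_act k
  | Flat => fun z : Z => val k *m z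
  | Compact => Mplus_act k
  end.

Definition Mminus_o : set_type Mminus := exist _ 0 (mem_set Mminus0).

Definition Mplus_of (z : Z) : set_type (range Mplus_class) :=
  exist _ (Mplus_class (z, 0)) (mem_set (imageT Mplus_class (z, 0))).

(* The inclusion of Z (of M^- when epsilon = -1) in M^epsilon, used as a chart
   at o = 0; outside [chart0_dom e] its value is arbitrary. *)
Definition chart0_dom (e : hss_type) : set Z :=
  if e is NonCompact then Mminus else setT.

Definition chart0 (e : hss_type) : Z -> Meps e :=
  match e return Z -> Meps e with
  | NonCompact => insubd Mminus_o
  | Flat => id
  | Compact => Mplus_of
  end.

Definition chart0_inv (e : hss_type) (m : Meps e) : Z :=
  xget 0 [set z | chart0_dom e z /\ chart0 e z = m].

(* The differential at o of the action of k in K, where T_o M^epsilon is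
   identified with Z through the canonical chart. *)
Definition isotropy (e : hss_type) (k : set_type Kaut) : Z -> Z :=
  'd (fun z => chart0_inv (K_act k (chart0 e z))) 0.

End JordanTriple.

(* K as a topological space (a subspace of GL(Z)) and as a group. *)
Definition Kgroup (R : realType) (n : nat) (T : jordanTriple R n) : Type :=
  set_type (Kaut T).

Section KGroup.
Context {R : realType} {n : nat}.
Variable T : jordanTriple R n.

HB.instance Definition _ := Topological.on (Kgroup T).
HB.instance Definition _ := Choice.on (Kgroup T).

Definition K_one : Kgroup T := exist _ 1%:M (mem_set (K1 T)).
Definition K_inv (k : Kgroup T) : Kgroup T :=
  exist _ (invmx (val k)) (mem_set (K_V (set_valP k))).
Definition K_mul (k l : Kgroup T) : Kgroup T :=
  exist _ (val k *m val l) (mem_set (K_M (set_valP k) (set_valP l))).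

Lemma K_unitmx (k : Kgroup T) : val k \in unitmx.
Proof. by have [] := K_aut (set_valP k). Qed.

Lemma K_mulA : associative K_mul.
Proof. by move=> k l m; apply: val_inj; rewrite /= mulmxA. Qed.
Lemma K_mul1 : left_id K_one K_mul.
Proof. by move=> k; apply: val_inj; rewrite /= mul1mx. Qed.
Lemma K_mul1r : right_id K_one K_mul.
Proof. by move=> k; apply: val_inj; rewrite /= mulmx1. Qed.
Lemma K_mulV : left_inverse K_one K_inv K_mul.
Proof. by move=> k; apply: val_inj; rewrite /= mulVmx ?K_unitmx. Qed.
Lemma K_mulVr : right_inverse K_one K_inv K_mul.
Proof. by move=> k; apply: val_inj; rewrite /= mulmxV ?K_unitmx. Qed.

HB.instance Definition _ := isGroup.Build (Kgroup T)
  K_mulA K_mul1 K_mul1r K_mulV K_mulVr.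

End KGroup.

(** * Complex Lie groups *)

HB.mixin Record isTopologicalGroup G of Topological G & Group G := {
  mulg_continuous : continuous (fun p : G * G => (p.1 * p.2)%g);
  invg_continuous : continuous (fun x : G => (x^-1)%g) }.

#[short(type="topologicalGroupType")]
HB.structure Definition TopologicalGroup :=
  {G of isTopologicalGroup G & Topological G & Group G}.

(* The atlas is indexed by the points of the group: [chart g] is a chart with
   domain [chart_dom g] around g, and [chart_inv g] its inverse. A map between
   open subsets of C^m is holomorphic when it is complex Frechet differentiable
   at each point. *)
HB.mixin Record isComplexLieGroup (R : realType) (m : nat) H
    of TopologicalGroup H := {
  lie_hausdorff : hausdorff_space H;
  chart_dom : H -> set H;
  chart : H -> H -> 'cV[Cplx R]_m;
  chart_inv : H -> 'cV[Cplx R]_m -> H;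
  chart_dom_open : forall g, open (chart_dom g);
  chart_dom_id : forall g, chart_dom g g;
  chartK : forall g x, chart_dom g x -> chart_inv g (chart g x) = x;
  chart_image_open : forall g, open (chart g @` chart_dom g);
  chart_continuous : forall g x, chart_dom g x ->
    {for x, continuous (chart g)};
  chart_inv_continuous : forall g y, (chart g @` chart_dom g) y ->
    {for y, continuous (chart_inv g)};
  chart_transition : forall g h y, (chart g @` (chart_dom g `&` chart_dom h)) y ->
    differentiable (chart h \o chart_inv g) y;
  mulg_holomorphic : forall g h,
    differentiable
      (fun p : 'cV[Cplx R]_m * 'cV[Cplx R]_m =>
         chart (g * h)%g (chart_inv g p.1 * chart_inv h p.2)%g)
      (chart g g, chart h h);
  invg_holomorphic : forall g,
    differentiable (fun y => chart (g^-1)%g (chart_inv g y)^-1%g) (chart g g) }.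

#[short(type="complexLieGroupType")]
HB.structure Definition ComplexLieGroup (R : realType) (m : nat) :=
  {H of isComplexLieGroup R m H & TopologicalGroup H}.

(* The tangent space T_e H, read in the chart at e. *)
Definition lie_algebra (R : realType) (m : nat) (H : complexLieGroupType R m) :
  Type := 'cV[Cplx R]_m.

HB.instance Definition _ (R : realType) (m : nat) (H : complexLieGroupType R m) :=
  NormedModule.on (lie_algebra H).

Section LieAlgebra.
Context {R : realType} {m : nat}.
Variable H : complexLieGroupType R m.
Local Notation lie_algebra := (lie_algebra H).

Definition Ad (h : H) : lie_algebra -> lie_algebra :=
  'd (fun y : lie_algebra => chart 1%g (h * chart_inv 1%g y * h^-1)%g)
     (chart 1%g (1%g : H)).

(* [X, Y] = ad(X) Y, with ad the differential of Ad at e. *)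
Definition lie_bracket (X Y : lie_algebra) : lie_algebra :=
  'd (fun y : lie_algebra => Ad (chart_inv 1%g y) Y) (chart 1%g (1%g : H)) X.

Definition is_subgroup (L : set H) : Prop :=
  L 1%g /\ forall x y, L x -> L y -> L (x * y^-1)%g.

Definition maximal_compact_subgroup (L : set H) : Prop :=
  [/\ is_subgroup L, compact L &
      forall L' : set H, is_subgroup L' -> compact L' -> L `<=` L' -> L' = L].

End LieAlgebra.

(** * The classifying sets *)

Section Classifying.
Context {R : realType} {n m : nat}.
Variables (T : jordanTriple R n) (H : complexLieGroupType R m) (L : set H).

(* A pair (f, b) with f : K -> H and b : T_o M^epsilon = Z -> Lie(H). *)
Definition pair_type : Type :=
  ((Kgroup T -> H) * ('cV[Cplx R]_n -> lie_algebra H))%type.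

(* f is a homomorphism of topological groups K -> L, and b is antilinear for the
   complex structure j_o of T_o M^epsilon = Z, which is multiplication by i. *)
Definition classifying_pair (e : hss_type) : set pair_type :=
  [set p : pair_type |
    [/\ [/\ forall k l, p.1 (k * l)%g = (p.1 k * p.1 l)%g,
             continuous p.1 & forall k, L (p.1 k)],
        forall (a : Cplx R) u v, p.2 (a *: u + v) = a^* *: p.2 u + p.2 v,
        forall k u, Ad (p.1 k) (p.2 u) = p.2 (isotropy e k u) &
        forall u v, lie_bracket (p.2 u) (p.2 v) = 0]].

Definition pair_equiv (p q : pair_type) : Prop :=
  exists2 l, L l & (forall k, q.1 k = (l * p.1 k * l^-1)%g) /\
                   (forall u, q.2 u = Ad l (p.2 u)).

Definition pair_class (e : hss_type) (p : pair_type) : set pair_type :=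
  [set q : pair_type | classifying_pair e q /\ pair_equiv p q].

Definition classifying_set (e : hss_type) : set (set pair_type) :=
  [set pair_class e p | p in classifying_pair e].

End Classifying.

(* Main.v *)
Require Import Defs.
From HB Require Import structures.
From mathcomp Require Import all_boot all_order all_algebra complex.
From mathcomp Require Import all_classical all_reals all_analysis.
Import Order.TTheory GRing.Theory Num.Theory numFieldNormedType.Exports.
Local Open Scope classical_set_scope.
Local Open Scope ring_scope.

(** The type of the space enters the classifying conditions only through the
    isotropy representation of K on T_o M^epsilon. In the chart at o given by
    the inclusion of a neighbourhood of 0 in Z, each k in K acts as the linear
    map z |-> k z, whatever epsilon, so that its differential at o is k itself.
    The sets of pairs (f, b) and their equivalence relations therefore
    coincide, and the correspondence is the identity. *)

(** The agreement near [x] holds at [x] too, so [f (y + x) - f x] is exactly [g y] for small [y]: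
    the remainder in the definition of the differential vanishes and needs no estimate. *)
Lemma near_linear_diff (K : numFieldType) (V W : normedModType K)
    (f : V -> W) (g : {linear V -> W}) (x : V) :
  continuous g -> (\forall y \near x, f y = g y) -> 'd f x = g :> (V -> W).
Proof.
move=> cg fg; apply: diff_unique => //; apply/eqaddoP => e e0.
have : \forall y \near 0, f (y + x) = g (y + x).
  by move: fg; rewrite (near_shift 0 x) subr0.
apply: filterS => y Ey.
rewrite /= !fctE /= Ey (nbhs_singleton fg) linearD [X in X - _]addrC subrr.
by rewrite normr0 mulr_ge0 // ltW.
Qed.

Lemma conj_continuous (R : realType) :
  continuous (Num.conj : Cplx R -> Cplx R).
Proof.
move=> x; apply/(@cvgrPdist_lt (Cplx R) (Cplx R) _ _
  (fmap_filter _ (nbhs_filter x))) => e e0.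
have xe := @nbhsx_ballx (Cplx R) (Cplx R) x e e0.
by apply: filterS xe => y; rewrite -ball_normE /= -rmorphB norm_conjC.
Qed.

Lemma real_complex_continuous (R : realType) :
  continuous (real_complex R : R -> Cplx R).
Proof.
move=> x; apply/(@cvgrPdist_lt (Cplx R) (Cplx R) _ _
  (fmap_filter _ (nbhs_filter x))) => e e0.
(* A positive element of [Cplx R] is real, so the complex radius [e] comes from a radius in [R]. *)
have [r er] : exists r, e = real_complex R r.
  by apply/complex_realP; rewrite gtr0_real.
move: e0; rewrite er ltcR => r0; have xr := @nbhsx_ballx R R x r r0.
apply: filterS xr => t.
rewrite -ball_normE /= -rmorphB [X in _ -> X < _]normc_def /=.
by rewrite expr0n addr0 sqrtr_sqr ltcR.
Qed.

Section Isotropy.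
Context {R : realType} {n : nat}.
Local Notation C := (Cplx R).
Local Notation Z := 'cV[C]_n.
Variable T : jordanTriple R n.

Lemma mulmx_diff (k : 'M[C]_n) (F : Z -> Z) :
  (\forall z \near (0 : Z), F z = k *m z) -> 'd F 0 = mulmx k :> (Z -> Z).
Proof.
exact: (@near_linear_diff C Z Z F (mulmx k) 0 (@mulmx_continuous R n n 1 k)).
Qed.

(** * Continuity of the triple product and of the Bergman determinant *)

Lemma tri0l v w : T 0 v w = 0.
Proof.
by have := tri_linear T v w (-1) 0 0; rewrite scaler0 addr0 scaleN1r addNr.
Qed.

Lemma tri0m u w : T u 0 w = 0.
Proof.
by have := tri_antilinear T u w (-1) 0 0;
  rewrite scaler0 addr0 rmorphN rmorph1 scaleN1r addNr.
Qed.

Lemma tri_suml v w (F : 'I_n -> Z) (a : 'I_n -> C) :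
  T (\sum_i a i *: F i) v w = \sum_i a i *: T (F i) v w.
Proof.
by elim/big_rec2: _ => [|i y z _ <-]; rewrite ?tri0l ?tri_linear.
Qed.

Lemma tri_summ u w (F : 'I_n -> Z) (a : 'I_n -> C) :
  T u (\sum_i a i *: F i) w = \sum_i (a i)^* *: T u (F i) w.
Proof.
by elim/big_rec2: _ => [|i y z _ <-]; rewrite ?tri0m ?tri_antilinear.
Qed.

(** Expanded in the standard basis, the triple product is a polynomial in the coordinates of [u] and
    [w] and the conjugate coordinates of [v]. *)
Lemma tri_continuous (X : topologicalType) (u v w : X -> Z) :
  continuous u -> continuous v -> continuous w ->
  continuous (fun x => T (u x) (v x) (w x)).
Proof.
move=> cu cv cw; pose e i : Z := delta_mx i 0.
have sumE (z : Z) : z = \sum_i z i 0 *: e i.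
  by rewrite [LHS]matrix_sum_delta; apply: eq_bigr => i _; rewrite big_ord1.
have cc (f : X -> Z) i : continuous f -> continuous (fun x => f x i 0).
  move=> cf x; apply: (@continuous_comp _ _ _ f (fun M : Z => M i 0)).
    exact: cf.
  exact: coord_continuous.
have -> : (fun x => T (u x) (v x) (w x)) = (fun x =>
    \sum_i u x i 0 *: \sum_j (v x j 0)^* *:
      \sum_l w x l 0 *: T (e i) (e j) (e l)).
  apply: funext => x; rewrite {1}(sumE (u x)) tri_suml; apply: eq_bigr => i _.
  rewrite {1}(sumE (v x)) tri_summ; congr (_ *: _); apply: eq_bigr => j _.
  (* Symmetry moves the third argument to the first slot, where [tri_suml] applies, and then
     back. *)
  rewrite {1}(sumE (w x)) triC tri_suml; congr (_ *: _); apply: eq_bigr => l _.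
  by rewrite triC.
apply: continuous_big => [|i _ x]; first exact: add_continuous.
apply: (@cvgZ C Z); first exact: cc.
move: x; apply: continuous_big => [|j _ x]; first exact: add_continuous.
apply: (@cvgZ C Z).
  apply: (@continuous_comp _ _ _ (fun x => v x j 0) Num.conj); first exact: cc.
  exact: conj_continuous.
move: x; apply: continuous_big => [|l _ x]; first exact: add_continuous.
by apply: (@cvgZ C Z); [exact: cc|exact: cvg_cst].
Qed.

Lemma det_continuous (X : topologicalType) (F : X -> 'M[C]_n) :
  (forall i j, continuous (fun x => F x i j)) -> continuous (fun x => \det (F x)).
Proof.
move=> cF; apply: continuous_big => [|s _ x]; first exact: add_continuous.
apply: (@cvgM C); first exact: cvg_cst.
move: x; apply: continuous_big => [|i _]; first exact: mul_continuous.
exact: cF.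
Qed.

Lemma det_bergman_continuous :
  continuous (fun z : Z => \det (bergman T z z)).
Proof.
apply: det_continuous => i j.
have entry z : bergman T z z i j =
    (delta_mx j 0 - 2 *: T z z (delta_mx j 0) + T z (T z (delta_mx j 0) z) z) i 0.
  by rewrite -[T z (_) z]/(tri_quad T z (tri_quad T z _)) -bergmanE -colE [RHS]mxE.
rewrite (funext entry) => z.
have cid : continuous (fun z : Z => z) by move=> ?; exact: cvg_id.
have ccst (a : Z) : continuous (fun _ : Z => a) by exact: cst_continuous.
apply: (@continuous_comp _ _ _ (fun z : Z => delta_mx j 0 -
  2 *: T z z (delta_mx j 0) + T z (T z (delta_mx j 0) z) z) (fun M : Z => M i 0));
  last exact: coord_continuous.
have c1 := tri_continuous _ _ _ _ cid cid (ccst (delta_mx j 0)).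
have c3 := tri_continuous _ _ _ _ cid (ccst (delta_mx j 0)) cid.
have c2 := tri_continuous _ _ _ _ cid c3 cid.
have Fz := nbhs_filter z.
apply: (@cvgD C Z _ _ Fz); last exact: c2.
apply: (@cvgB C Z _ _ Fz); first exact: cvg_cst.
by apply: (@cvgZ C Z _ _ Fz (fun=> 2)); [exact: cvg_cst|exact: c1].
Qed.

(** Quasi-invertibility of [(z, z)] persists on a ball around 0, and each point of that ball is
    joined to 0 by a segment inside it, hence lies in the component of 0. *)
Lemma Mminus_nbhs : nbhs (0 : Z) (Mminus T).
Proof.
have q0 : quasi_invertible T 0 0.
  exact: connected_component_sub (Mminus0 T).
have /nbhs_ballP[e e0 eB] : nbhs (0 : Z) [set z | quasi_invertible T z z].
  have U0 : nbhs (\det (bergman T 0 0)) [set x : C | x != 0].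
    (* The ball around this determinant with its modulus as radius misses 0. *)
    have d0 : 0 < `|\det (bergman T 0 0)| by rewrite normr_gt0.
    apply: filterS (@nbhsx_ballx C C _ _ d0) => x; rewrite -ball_normE /=.
    by apply: contraTneq => ->; rewrite subr0 ltxx.
  exact: (det_bergman_continuous 0 _ U0).
apply/nbhs_ballP; exists e => // z ze.
exists [set real_complex R t *: z | t in `[0, 1]].
  split.
  - by exists 0; rewrite ?rmorph0 ?scale0r //= in_itv /= lexx ler01.
  - move=> _ [t /= /[!in_itv]/= /andP[t0 t1] <-]; apply: eB.
    move: ze; rewrite -!ball_normE /= !sub0r !normrN normrZ; apply: le_lt_trans.
    rewrite ler_piMl //.
    by rewrite ger0_norm ?ler0c // -[1]/(real_complex R 1) lecR.
  apply: connected_continuous_connected; first exact: segment_connected.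
  apply: continuous_subspaceT => t; apply: (@cvgZ C Z); last exact: cvg_cst.
  exact: real_complex_continuous.
by exists 1; rewrite ?rmorph1 ?scale1r //= in_itv /= lexx ler01.
Qed.

(** * The chart at [o] and the action of [K] in it *)

Lemma bergmanz0 (z : Z) : bergman T z 0 = 1%:M.
Proof.
apply: mulmx_colI => x.
by rewrite bergmanE /tri_quad tri0l !tri0m scaler0 subr0 addr0 mul1mx.
Qed.

(** Equal second entries leave the quasi-inverse of [z] at 0, which is [z] itself. This makes the
    inclusion of Z in the compact space injective. *)
Lemma Mplus_class_z0 (z w : Z) : Mplus_class T (z, 0) (w, 0) <-> w = z.
Proof.
rewrite /Mplus_class /= subrr /quasi_invertible /quasi_inverse bergmanz0 det1.
rewrite invmx1 mul1mx /tri_quad tri0m subr0.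
by split=> [[]//|]; split=> //; rewrite oner_neq0.
Qed.

(** As [chart0_inv] chooses a preimage in the domain, injectivity of [chart0] there is what must be
    shown. *)
Lemma chart0K e z : chart0_dom T e z -> chart0_inv (chart0 T e z) = z.
Proof.
move=> ez; apply: xget_unique => // w [ew].
case: e ez ew => //= ez ew.
  by move=> /(congr1 val); rewrite !insubdK ?inE.
(* Equal classes of [(w, 0)] and [(z, 0)] both contain [(w, 0)], which forces [w = z]. *)
by move=> /(congr1 val)/= E; apply/Mplus_class_z0; rewrite -E; apply/Mplus_class_z0.
Qed.

Lemma K_act_chart0 e (k : set_type (Kaut T)) z : chart0_dom T e z ->
  K_act k (chart0 T e z) = chart0 T e (val k *m z).
Proof.
have kaut := K_aut (set_valP k).
case: e => // ez; apply: val_inj.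
  by rewrite /= !insubdK ?inE //; exact: Mminus_aut.
(* The class of [(z, 0)] goes to that of [(k z, k 0)], and [k 0 = 0]. *)
rewrite [LHS](Mplus_image_class (z, 0) kaut).
by congr Mplus_class; rewrite /= mulmx0.
Qed.

Lemma chart0_dom_aut e (k : set_type (Kaut T)) z :
  chart0_dom T e z -> chart0_dom T e (val k *m z).
Proof. by case: e => //=; apply: Mminus_aut; exact/K_aut/set_valP. Qed.

Lemma chart0_dom_nbhs e : nbhs (0 : Z) (chart0_dom T e).
Proof.
have Z0 : nbhs (0 : Z) setT by apply: (@filterT _ _ (nbhs_filter _)).
by case: e => //=; exact: Mminus_nbhs.
Qed.

Lemma isotropyE e (k : set_type (Kaut T)) (u : Z) : isotropy e k u = val k *m u.
Proof.
rewrite /isotropy (@mulmx_diff (val k)) //.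
(* The chart is meaningful only on its domain, but a differential at 0 sees only a neighbourhood of
   0. *)
apply: filterS (chart0_dom_nbhs e) => z ez.
by rewrite K_act_chart0 // chart0K //; exact: chart0_dom_aut.
Qed.

End Isotropy.

Lemma classifying_pair_indep (R : realType) (n m : nat) (T : jordanTriple R n)
    (H : complexLieGroupType R m) (L : set H) (e e' : hss_type) :
  classifying_pair L e = classifying_pair L e' :> set (pair_type T H).
Proof.
have isoE : @isotropy R n T e = @isotropy R n T e'.
  by apply/funext => k; apply/funext => u; rewrite 2!isotropyE.
by rewrite /classifying_pair isoE.
Qed.

Theorem corollary6p6 (R : realType) (n m : nat) (T : jordanTriple R n)
    (H : complexLieGroupType R m) (L : set H)
    (T_positive : positive_triple T) (T_irreducible : irreducible_triple T)
    (H_connected : connected [set: H]) (L_max : maximal_compact_subgroup L) :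
  forall e e' : hss_type,
    exists Phi : set (pair_type T H) -> set (pair_type T H),
      set_bij (classifying_set L e) (classifying_set L e') Phi /\
      (forall p : pair_type T H, classifying_pair L e p ->
         classifying_pair L e' p /\
         Phi (pair_class L e p) = pair_class L e' p).
Proof.
move=> e e'; exists id.
rewrite /classifying_set /pair_class (classifying_pair_indep _ _ _ _ _ _ e e').
by split=> //; split=> [p|p q _ _|p Ep] //; exists p.
Qed.
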